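(* Let $A, B \in \mathbb{R}^{n \times n}$ be given. The following are equivalent. (i) There exist diagonal matrices $P \succ 0$, $Q \succ 0$ in $\mathbb{R}^{n\times n}$ satisfying $A^TP+PA + Q + PBQ^{-1}B^TP \prec 0$. (iia) For every non-zero positive semi-definite matrix $H = \begin{pmatrix} H_{11} & H_{12} \\ H_{12}^T & H_{22}\end{pmatrix}$ in $\mathrm{Sym}(2n, \mathbb{R})$ (with $n \times n$ blocks) satisfying $\mathrm{diag}(H_{11}) = \mathrm{diag}(H_{22})$, the matrix $AH_{11} + BH_{12}^T$ has a negative diagonal entry.
   Context: $M \succ 0$ ($M \prec 0$) means that the real matrix $M = M^T$ is positive definite (negative definite). $\mathrm{Sym}(m,\mathbb{R})$ is the space of real symmetric $m \times m$ matrices. For $M \in \mathbb{R}^{n\times n}$, $\mathrm{diag}(M) \in \mathbb{R}^n$ is the vector of diagonal entries of $M$. *)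

(* Defs.v *)
From mathcomp Require Import all_boot all_order all_algebra.
From mathcomp Require Import reals.

Set Implicit Arguments.
Unset Strict Implicit.
Unset Printing Implicit Defensive.

Import Order.TTheory GRing.Theory Num.Theory.

Local Open Scope ring_scope.

(* Definiteness includes symmetry: over the reals, the sign of the quadratic
   form alone does not force M^T = M. *)
Definition posdefmx (R : realType) (m : nat) (M : 'M[R]_m) : Prop :=
  M^T = M /\ forall x : 'cV[R]_m, x != 0 -> 0 < (x^T *m M *m x) 0 0.

Definition negdefmx (R : realType) (m : nat) (M : 'M[R]_m) : Prop :=
  M^T = M /\ forall x : 'cV[R]_m, x != 0 -> (x^T *m M *m x) 0 0 < 0.

Definition possemidefmx (R : realType) (m : nat) (M : 'M[R]_m) : Prop :=
  M^T = M /\ forall x : 'cV[R]_m, 0 <= (x^T *m M *m x) 0 0.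

Definition diagv (R : realType) (n : nat) (M : 'M[R]_n) : 'cV[R]_n :=
  \col_i M i i.

(* Main.v *)
Require Import Defs.
From mathcomp Require Import all_boot all_order all_algebra.
From mathcomp Require Import reals.
From mathcomp Require Import boolp classical_sets topology normedtype derive.
From mathcomp Require Import ring lra.

(** By Schur complements, the Riccati inequality for diagonal [P] and positive
    diagonal [Q] says that the block matrix
    [L = block_mx (A^T *m P + P *m A + Q) (P *m B) (P *m B)^T (- Q)]
    is negative definite ([schur_complement]); the positivity of [Q] is then
    automatic. This condition is linear in the diagonals [p] and [q] of [P] and
    [Q], and for symmetric [H] ([mxtrace_lmi])
    [\tr (L *m H) = 2 * \sum_i p_i y_i(H) + \sum_i q_i z_i(H)],
    where [y_i(H)] is the [i]-th diagonal entry of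
    [A *m ulsubmx H + B *m (ursubmx H)^T] and [z_i(H)] is the difference of the
    [i]-th diagonal entries of the two diagonal blocks of [H]. Thus the theorem
    is a theorem of the alternative for the positive semidefinite cone.

    If [L] is negative definite, then the trace is negative for every nonzero
    positive semidefinite [H], as is seen by writing [H = C^T *m C]
    ([psd_gram], [negdef_mxtrace]). When all [z_i(H)] vanish and all [p_i] are
    positive, some [y_i(H)] must be negative.

    Conversely, on the compact convex set of positive semidefinite matrices of
    trace 1 ([density_compact], [density_convex]) the function
    [f(H) = \sum_i min(y_i(H), 0)^2 + \sum_i z_i(H)^2] is positive by
    hypothesis, so it has a positive minimum at some [u]. Optimality at [u]
    makes [p_i = - min(y_i(u), 0)] and [q_i = - z_i(u)] multipliers for which
    the combination is at most [- f(u)] on the whole set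
    ([penalty_optimality]). There is room to make the [p_i] strictly positive
    ([density_separation]), and negativity of the trace against all density
    matrices is negative definiteness of [L] ([negdef_density]). *)

Set Implicit Arguments.
Unset Strict Implicit.
Unset Printing Implicit Defensive.

Import Order.TTheory GRing.Theory Num.Theory.
Import numFieldTopology.Exports numFieldNormedType.Exports.

Local Open Scope classical_set_scope.
Local Open Scope ring_scope.

Local Notation qform M x := ((x^T *m M *m x) 0 0).

(** * Definite matrices and Schur complements *)

Lemma sumsq_gt0 (R : realType) (I : finType) (a : I -> R) i :
  a i != 0 -> 0 < \sum_j a j ^+ 2.
Proof.
move=> ai_neq0; rewrite (bigD1 i) //= ltr_pwDl ?exprn_even_gt0 //.
by apply: sumr_ge0 => j _; exact: sqr_ge0.
Qed.

(** A row of the left kernel of [M] is a vector on which the form vanishes. *)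
Lemma posdefmx_unit (R : realType) m (M : 'M[R]_m) : posdefmx M -> M \in unitmx.
Proof.
case=> sM pM; rewrite -row_free_unit -kermx_eq0; apply/eqP/row_matrixP => i.
rewrite row0; apply/eqP; apply: contraT => ker_neq0.
have /= := pM (row i (kermx M))^T; rewrite trmx_eq0 => /(_ ker_neq0).
by rewrite trmxK -row_mul mulmx_ker row0 mul0mx mxE ltxx.
Qed.

Lemma qform_diag (R : realType) m (d : 'rV[R]_m) (x : 'cV[R]_m) :
  qform (diag_mx d) x = \sum_i d 0 i * x i 0 ^+ 2.
Proof.
rewrite mul_mx_diag mxE; apply: eq_bigr => i _; rewrite !mxE; ring.
Qed.

Lemma posdef_diagP (R : realType) m (d : 'rV[R]_m) :
  posdefmx (diag_mx d) <-> forall i, 0 < d 0 i.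
Proof.
split=> [[_ pd] i|d_gt0].
  have /pd : delta_mx i 0 != 0 :> 'cV[R]_m.
    by apply/eqP => /colP /(_ i); rewrite !mxE !eqxx => /eqP; rewrite oner_eq0.
  rewrite qform_diag (bigD1 i) //= big1 => [|j ji]; last first.
    by rewrite mxE (negPf ji) /= expr0n mulr0.
  by rewrite mxE !eqxx expr1n mulr1 addr0.
split=> [|x]; first exact: tr_diag_mx.
rewrite qform_diag => x_neq0.
have term_ge0 i : 0 <= d 0 i * x i 0 ^+ 2 by rewrite mulr_ge0 ?sqr_ge0 ?ltW.
rewrite lt_def sumr_ge0 // andbT; apply: contra x_neq0 => /eqP sum0.
apply/eqP/colP => i; rewrite mxE; apply/eqP.
have /(_ i isT)/eqP := psumr_eq0P (fun i _ => term_ge0 i) sum0.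
by rewrite mulf_eq0 sqrf_eq0 gt_eqF.
Qed.

(** Completing the square in [w]. The subtracted square vanishes at
    [w = invmx Q *m Y^T *m x], which is how the two ways of reading this
    identity in [schur_complement] arise. *)
Lemma qform_schur (R : realType) n (X Y Q : 'M[R]_n) (x w : 'cV[R]_n) :
  Q^T = Q -> Q \in unitmx ->
  qform (block_mx X Y Y^T (- Q)) (col_mx x w) =
  qform (X + Y *m invmx Q *m Y^T) x - qform Q (w - invmx Q *m Y^T *m x).
Proof.
move=> sQ uQ; rewrite tr_col_mx mul_row_block mul_row_col.
rewrite [(w - _)^T]linearB /= !trmx_mul trmxK trmx_inv sQ.
rewrite mulmxBr mulmxBl [x^T *m (Y *m _)]mulmxA mulmxKV //.
rewrite mulmxBl !mulmxDl !mulmxDr !mulmxA [w^T *m Q *m invmx Q]mulmxK //.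
rewrite mulmxDl mulmxN !mulNmx; do 5!move: (_ *m _).
by move=> *; rewrite !mxE; ring.
Qed.

Lemma schur_complement (R : realType) n (X Y Q : 'M[R]_n) :
  X^T = X -> Q^T = Q ->
  negdefmx (block_mx X Y Y^T (- Q)) <->
  posdefmx Q /\ negdefmx (X + Y *m invmx Q *m Y^T).
Proof.
move=> sX sQ; have sL : (block_mx X Y Y^T (- Q))^T = block_mx X Y Y^T (- Q).
  by rewrite tr_block_mx trmxK linearN /= sX sQ.
have sS : (X + Y *m invmx Q *m Y^T)^T = X + Y *m invmx Q *m Y^T.
  by rewrite linearD /= !trmx_mul trmxK trmx_inv sX sQ mulmxA.
split=> [[_ nL]|[pQ [_ nS]]].
  have pQ : posdefmx Q.
    split=> // w w_neq0; have /nL : col_mx 0 w != 0 :> 'cV[R]_(n + n).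
      by rewrite col_mx_eq0 eqxx.
    rewrite tr_col_mx mul_row_block mul_row_col trmx0 !mul0mx mulmx0 !add0r.
    by rewrite mulmxN mulNmx mxE oppr_lt0.
  split=> //; split=> // x x_neq0.
  have /nL : col_mx x (invmx Q *m Y^T *m x) != 0.
    by rewrite col_mx_eq0 (negPf x_neq0).
  rewrite qform_schur ?posdefmx_unit // subrr trmx0 !mul0mx.
  by rewrite [X in _ - X]mxE subr0.
split=> // v; rewrite -[v]vsubmxK; move: (usubmx v) (dsubmx v) => x w.
rewrite qform_schur ?posdefmx_unit // col_mx_eq0.
have [->|x_neq0 _] := eqVneq x 0.
  move=> /pQ.2 w_gt0.
  by rewrite !mulmx0 subr0 [X in X - _]mxE sub0r oppr_lt0.
have := nS x x_neq0; set u := w - _.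
have : 0 <= qform Q u.
  have [->|/pQ.2/ltW//] := eqVneq u 0; by rewrite mulmx0 mxE.
lra.
Qed.

(** * Gram factorization of positive semidefinite matrices *)

(** The form at [t e_i + e_j]. *)
Lemma psd_entry (R : realType) m (H : 'M[R]_m) (i j : 'I_m) (t : R) :
  possemidefmx H -> 0 <= t ^+ 2 * H i i + 2 * t * H i j + H j j.
Proof.
case=> sH pH; have Hji : H j i = H i j by rewrite -[in LHS]sH mxE.
have := pH (t *: delta_mx i 0 + delta_mx j 0).
rewrite [(_ + _)^T]linearD /= [trmx (t *: _)]linearZ /= !trmx_delta.
rewrite !mulmxDl !mulmxDr -!scalemxAl -!scalemxAr.
rewrite -!rowE -!colE !mxE Hji; congr (_ <= _); ring.
Qed.

(** One step of symmetric Gaussian elimination. Evaluating the form at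
    [(- a^-1 * (b *m x), x)] minimizes it over the first coordinate and leaves
    the Schur complement of [a]. Since [0^-1 = 0], the same vector and the same
    formula cover [a = 0], in which case [b] vanishes as well. *)
Lemma psd_pivot (R : realType) m (a : R) (b : 'rV[R]_m) (D : 'M[R]_m) :
  possemidefmx (block_mx a%:M b b^T D) ->
  [/\ 0 <= a, a = 0 -> b = 0 & possemidefmx (D - a^-1 *: (b^T *m b))].
Proof.
move=> psdH; have [sH pH] := psdH.
have defa : block_mx a%:M b b^T D (lshift m 0) (lshift m 0) = a.
  by rewrite block_mxEul mxE eqxx.
split.
- by have := psd_entry (lshift m 0) (lshift m 0) 0 psdH; rewrite defa; lra.
- move=> a0; apply/rowP => j; rewrite [RHS]mxE; apply/eqP.
  apply: contraT => bj_neq0.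
  (* This value of [t] makes the form equal to [-1]. *)
  have := psd_entry (lshift m 0) (rshift 1 j)
            (- (D j j + 1) / (2 * b 0 j)) psdH.
  rewrite defa block_mxEur block_mxEdr a0 mulr0 add0r.
  have -> : 2 * (- (D j j + 1) / (2 * b 0 j)) * b 0 j = - (D j j + 1) by field.
  lra.
have [_ _ _ sD] := eq_block_mx (etrans (esym (tr_block_mx _ _ _ _)) sH).
split=> [|x].
  by rewrite linearB /= [trmx (_ *: _)]linearZ /= trmx_mul trmxK sD.
pose s := (b *m x) 0 0.
have bx : b *m x = s%:M by exact: mx11_scalar.
have xb : x^T *m b^T = s%:M by rewrite -trmx_mul bx tr_scalar_mx.
have := pH (col_mx (- (a^-1 * s))%:M x).
rewrite tr_col_mx mul_row_block mul_row_col tr_scalar_mx xb.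
rewrite !mulmxDl -[_ *m b *m x]mulmxA bx -!scalar_mxM.
rewrite mulmxBr mulmxBl -scalemxAr -scalemxAl mulmxA xb -[_ *m b *m x]mulmxA bx.
rewrite -!scalar_mxM scale_scalar_mx.
move: (x^T *m D *m x) => E; rewrite !mxE !eqxx !mulr1n.
have [->|a_neq0] := eqVneq a 0.
  by rewrite invr0; congr (_ <= _); ring.
by congr (_ <= _); field.
Qed.

(** Cholesky factorization, by recursion on the Schur complement of the corner.
    It writes [H] as a sum of rank-one matrices [v *m v^T], against which the
    trace of [L] is the quadratic form of [L]. *)
Lemma psd_gram (R : realType) m (H : 'M[R]_m) :
  possemidefmx H -> exists C : 'M[R]_m, H = C^T *m C.
Proof.
elim: m H => [|m IHm] H psdH; first by exists 0; apply/matrixP => -[].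
move: (H) psdH; rewrite -[m.+1]/(1 + m)%N => {}H psdH.
have defH : H = block_mx (H 0 0)%:M (ursubmx H) (ursubmx H)^T (drsubmx H).
  rewrite -[LHS]submxK trmx_ursub psdH.1; congr block_mx.
  by rewrite [LHS]mx11_scalar !mxE; congr (H _ _)%:M; apply/val_inj.
rewrite defH in psdH *; move: (H 0 0) (ursubmx H) (drsubmx H) psdH => a b D.
case/psd_pivot => a_ge0 b0 /IHm [C' defC'].
pose c := Num.sqrt a.
exists (block_mx c%:M (c^-1 *: b) 0 C').
have cc : c * c = a by rewrite -expr2 sqr_sqrtr.
have cVb : c *: (c^-1 *: b) = b.
  rewrite scalerA; have [c0|c_neq0] := eqVneq c 0.
    by rewrite b0 ?scaler0 // -cc c0 mul0r.
  by rewrite divff ?scale1r.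
rewrite tr_block_mx mulmx_block -defC' !tr_scalar_mx trmx0.
rewrite !mul0mx !mulmx0 !addr0.
congr block_mx.
- by rewrite -scalar_mxM cc.
- by rewrite mul_scalar_mx cVb.
- by rewrite mul_mx_scalar -linearZ /= cVb.
rewrite [trmx (_ *: _)]linearZ /= -scalemxAl -scalemxAr scalerA -invfM cc.
by rewrite addrC subrK.
Qed.

(** * Trace duality *)

Definition lyap_entry (R : realType) n (A B : 'M[R]_n) (i : 'I_n)
    (H : 'M[R]_(n + n)) : R :=
  diagv (A *m ulsubmx H + B *m (ursubmx H)^T) i 0.

Definition diag_gap (R : realType) n (i : 'I_n) (H : 'M[R]_(n + n)) : R :=
  diagv (ulsubmx H) i 0 - diagv (drsubmx H) i 0.

Lemma mxtrace_diagM (R : realType) n (d : 'rV[R]_n) (M : 'M[R]_n) :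
  \tr (diag_mx d *m M) = \sum_i d 0 i * M i i.
Proof. by rewrite mul_diag_mx; apply: eq_bigr => i _; rewrite mxE. Qed.

(** The adjoint computation behind the theorem: as a functional of [H], the
    trace against the block matrix is a combination of the diagonal entries in
    the alternative condition, with the diagonals of the multipliers as
    coefficients. *)
Lemma mxtrace_lmi (R : realType) n (A B : 'M[R]_n) (p q : 'rV[R]_n)
    (H : 'M[R]_(n + n)) : H^T = H ->
  \tr (block_mx (A^T *m diag_mx p + diag_mx p *m A + diag_mx q)
         (diag_mx p *m B) (diag_mx p *m B)^T (- diag_mx q) *m H) =
  2 * (\sum_i p 0 i * lyap_entry A B i H) + \sum_i q 0 i * diag_gap i H.
Proof.
move=> sH; rewrite /lyap_entry /diag_gap.
have sU : (ulsubmx H)^T = ulsubmx H by rewrite trmx_ulsub sH.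
rewrite -[in LHS](submxK H) mulmx_block mxtrace_block.
rewrite -[dlsubmx H]trmxK trmx_dlsub sH.
move: (ulsubmx H) (ursubmx H) (drsubmx H) sU => U V W sU.
rewrite !mulmxDl !mxtraceD.
have -> : \tr (A^T *m diag_mx p *m U) = \tr (diag_mx p *m A *m U).
  by rewrite -mxtrace_tr !trmx_mul tr_diag_mx trmxK sU mxtrace_mulC.
have -> : \tr ((diag_mx p *m B)^T *m V) = \tr (diag_mx p *m B *m V^T).
  by rewrite -mxtrace_tr trmx_mul trmxK mxtrace_mulC.
rewrite mulNmx linearN /= -!mulmxA !mxtrace_diagM.
have diagvE (M : 'M[R]_n) i : diagv M i 0 = M i i by rewrite mxE.
under [X in 2 * X]eq_bigr do
  rewrite diagvE [fun_of_matrix (_ + _) _ _]mxE mulrDr.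
under [X in _ = _ + X]eq_bigr do rewrite !diagvE mulrBr.
rewrite big_split sumrB /=; ring.
Qed.

Lemma mxtrace_gram (R : realType) m (L C : 'M[R]_m) :
  \tr (L *m (C^T *m C)) = \sum_k qform L (row k C)^T.
Proof.
rewrite mulmxA mxtrace_mulC; apply: eq_bigr => k _.
by rewrite trmxK -row_mul mulmxA !mxE; apply: eq_bigr => j _; rewrite !mxE.
Qed.

Lemma negdef_mxtrace (R : realType) m (L H : 'M[R]_m) :
  negdefmx L -> possemidefmx H -> H != 0 -> \tr (L *m H) < 0.
Proof.
move=> [_ nL] /psd_gram [C ->] H_neq0; rewrite mxtrace_gram.
have term_le0 k : qform L (row k C)^T <= 0.
  have [->|/nL/ltW//] := eqVneq (row k C)^T 0; by rewrite mulmx0 mxE.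
have [k Ck_neq0] : exists k, row k C != 0.
  apply/existsP; apply: contraT => /existsPn rows0; case/negP: H_neq0.
  suff -> : C = 0 by rewrite mulmx0.
  by apply/row_matrixP => k; rewrite row0; apply/eqP/negbNE/rows0.
rewrite (bigD1 k) //= -[ltRHS]addr0; apply: ltr_leD.
  by apply: nL; rewrite trmx_eq0.
by rewrite -oppr_ge0 -sumrN; apply: sumr_ge0 => j _; rewrite oppr_ge0.
Qed.

(** * Optimality of a quadratic penalty *)

(** A parabola through the origin that is nonnegative on [0, 1] cannot start
    downwards. *)
Lemma quadratic_slope_ge0 (R : realType) (G K : R) : 0 <= K ->
  (forall t, 0 <= t <= 1 -> 0 <= 2 * t * G + t ^+ 2 * K) -> 0 <= G.
Proof.
move=> K_ge0 quad; rewrite leNgt; apply/negP => G_lt0.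
have KG_gt0 : 0 < K - G by lra.
(* The parabola has its minimum at [- G / K]. Adding [- G] to the denominator
   gives a point of [0, 1], also when [K = 0], at which the value is still
   negative. *)
have t_gt0 : 0 < - G / (K - G) by rewrite divr_gt0 ?oppr_gt0.
have t_le1 : - G / (K - G) <= 1 by rewrite ler_pdivrMr // mul1r; lra.
have := quad (- G / (K - G)); rewrite (ltW t_gt0) t_le1 => /(_ isT).
have -> : 2 * (- G / (K - G)) * G + (- G / (K - G)) ^+ 2 * K =
  - (G / (K - G)) ^+ 2 * (K - 2 * G).
  by field; rewrite gt_eqF.
have : 0 < (G / (K - G)) ^+ 2 by rewrite -sqrrN -mulNr exprn_gt0.
nra.
Qed.

(** First-order optimality, with multipliers read off the minimizer. The value
    [f w] is the squared distance from [(y w, z w)] to the cone of pairs with a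
    nonnegative first and a zero second component. If [u] minimizes [f] on the
    segment towards [v], then the difference between [(y u, z u)] and its
    projection onto the cone defines a hyperplane with [v] on its negative
    side, at a level that depends on [u] only. Measuring the distance along the
    segment to that same projection, instead of the moving one, bounds [f] from
    above by a parabola with equality at [u], so [quadratic_slope_ge0]
    applies. *)
Lemma penalty_optimality (R : realType) (V : lmodType R)
    (I J : finType) (y : I -> V -> R) (z : J -> V -> R) (u v : V) :
  let f w := \sum_i Num.min (y i w) 0 ^+ 2 + \sum_j z j w ^+ 2 in
  (forall i t, y i (u + t *: (v - u)) = y i u + t * (y i v - y i u)) ->
  (forall j t, z j (u + t *: (v - u)) = z j u + t * (z j v - z j u)) ->
  (forall t, 0 <= t <= 1 -> f u <= f (u + t *: (v - u))) ->
  \sum_i - Num.min (y i u) 0 * y i v + \sum_j - z j u * z j v <= - f u.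
Proof.
move=> f affy affz umin.
set G := \sum_i Num.min (y i u) 0 * (y i v - y i u)
         + \sum_j z j u * (z j v - z j u).
set K := \sum_i (y i v - y i u) ^+ 2 + \sum_j (z j v - z j u) ^+ 2.
have sum_sqr (T : finType) (a d : T -> R) (t : R) :
    \sum_i (a i + t * d i) ^+ 2 =
    \sum_i a i ^+ 2 + 2 * t * (\sum_i a i * d i) + t ^+ 2 * \sum_i d i ^+ 2.
  rewrite !mulr_sumr -!big_split; apply: eq_bigr => i _ /=; ring.
have G_ge0 : 0 <= G.
  apply: (@quadratic_slope_ge0 _ G K).
    by rewrite addr_ge0 ?sumr_ge0 // => *; exact: sqr_ge0.
  move=> t t01; rewrite -(lerD2l (f u)) addr0.
  apply: (le_trans (umin t t01)); rewrite /f.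
  have -> : \sum_i Num.min (y i u) 0 ^+ 2 + \sum_j z j u ^+ 2
      + (2 * t * G + t ^+ 2 * K) =
    \sum_i (Num.min (y i u) 0 + t * (y i v - y i u)) ^+ 2
    + \sum_j (z j u + t * (z j v - z j u)) ^+ 2.
    by rewrite !sum_sqr /G /K; ring.
  apply: lerD; apply: ler_sum => i _; last by rewrite affz.
  rewrite affy; move: (y i u) (t * _) => a d.
  rewrite /Num.min; case: ltP => ad; case: ltP => a0; nra.
have -> : \sum_i - Num.min (y i u) 0 * y i v + \sum_j - z j u * z j v =
    - f u - G.
  have sum_lin (T : finType) (a d b : T -> R) :
      (forall i, a i * b i = a i ^+ 2) ->
      \sum_i - a i * d i = - (\sum_i a i ^+ 2) - \sum_i a i * (d i - b i).
    move=> ab; rewrite -opprD -big_split -sumrN; apply: eq_bigr => i _ /=.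
    by rewrite -ab; ring.
  rewrite (sum_lin _ _ _ (y^~ u)) ?(sum_lin _ (z^~ u) _ (z^~ u)) /f /G //.
    by ring.
  move=> i; rewrite /Num.min; case: ifP => _; [exact: expr2 | ring].
lra.
Qed.

(** * Compactness of the density matrices *)

(** Density matrices: a base of the positive semidefinite cone, chosen for its
    compactness. *)
Definition density (R : realType) m (H : 'M[R]_m) : Prop :=
  possemidefmx H /\ \tr H = 1.

Lemma density_entry_le1 (R : realType) m (H : 'M[R]_m) i j :
  density H -> `|H i j| <= 1.
Proof.
case=> psdH trH.
have diag_ge0 k : 0 <= H k k by have := psd_entry k k 0 psdH; lra.
have diag_le1 k : H k k <= 1.
  by rewrite -trH /mxtrace (bigD1 k) //= lerDl sumr_ge0.
rewrite ler_norml.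
have := psd_entry i j 1 psdH; have := psd_entry i j (-1) psdH.
have := diag_le1 i; have := diag_le1 j; move: (H i j) (H i i) (H j j) => *; nra.
Qed.

Lemma continuous_sum (R : realType) (T : topologicalType) (I : Type)
    (r : seq I) (g : I -> T -> R) :
  (forall i, continuous (g i)) -> continuous (fun v => \sum_(i <- r) g i v).
Proof.
move=> cg v; elim: r => [|i r IHr].
  by under eq_fun do rewrite big_nil; exact: cvg_cst.
under eq_fun do rewrite big_cons.
by apply: cvgD => //; exact: cg.
Qed.

Lemma continuous_mulmx (R : realType) (T : topologicalType) m n p
    (F : T -> 'M[R]_(m, n)) (G : T -> 'M[R]_(n, p)) :
  (forall i j, continuous (fun v => F v i j)) ->
  (forall i j, continuous (fun v => G v i j)) ->
  forall i j, continuous (fun v => (F v *m G v) i j).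
Proof.
move=> cF cG i j; under eq_fun do rewrite mxE.
by apply: continuous_sum => k v; apply: cvgM; [exact: cF | exact: cG].
Qed.

Lemma continuous_qform (R : realType) m (x : 'cV[R]_m) :
  continuous (fun H : 'M[R]_m => qform H x).
Proof.
apply: (@continuous_mulmx R 'M[R]_m _ _ _ (fun H => x^T *m H) (fun=> x)).
  apply: (@continuous_mulmx R 'M[R]_m _ _ _ (fun=> x^T) id) => k l.
    exact: cst_continuous.
  exact: coord_continuous.
by move=> k l; exact: cst_continuous.
Qed.

(** Reshaping row vectors into matrices is an isometry for the sup norm, so the
    compactness of cubes passes from row vectors to matrices. *)
Lemma cube_compact (R : realType) m n :
  compact [set H : 'M[R]_(m, n) | forall i j, `|H i j| <= 1].
Proof.
pose itv : set R := `[(-1 : R), 1]%classic.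
pose cube := [set v : 'rV[R]_(m * n) | forall k, itv (v ord0 k)].
have cptcube : compact cube.
  by apply: (@rV_compact R _ (fun=> itv)) => _; exact: segment_compact.
suff -> : [set H : 'M[R]_(m, n) | forall i j, `|H i j| <= 1] = vec_mx @` cube.
  apply: continuous_compact => //; apply: continuous_subspaceT.
  move=> v U /nbhs_ballP[e /= e_gt0 sube].
  apply/nbhs_ballP; exists e => //= w [_ vw]; apply: sube; split => // i j.
  by rewrite !mxE; exact: vw.
apply/seteqP; split=> [H cubeH | _ [v cubev <-] i j] /=; last first.
  by have := cubev (mxvec_index i j); rewrite /itv /= in_itv /= mxE ler_norml.
exists (mxvec H); last exact: mxvecK.
move=> k; case/mxvec_indexP: k => i j.
by rewrite mxvecE /itv /= in_itv /= -ler_norml; exact: cubeH.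
Qed.

Lemma density_compact (R : realType) m : compact [set H : 'M[R]_m | density H].
Proof.
apply: subclosed_compact (@cube_compact R m m) _ => [|H dH i j]; last first.
  exact: density_entry_le1.
rewrite (_ : [set H | _] =
  ((\bigcap_(ij in [set: 'I_m * 'I_m])
     [set H : 'M[R]_m | H ij.1 ij.2 - H ij.2 ij.1 = 0]) `&`
   (\bigcap_(x in [set: 'cV[R]_m]) [set H : 'M[R]_m | 0 <= qform H x])) `&`
  [set H | \tr H = 1]).
  apply: closedI; first apply: closedI.
  - apply: closed_bigI => -[i j] _ /=.
    apply: (@preimage_closed 'M[R]_m R (fun H => H i j - H j i) _ _
              (@closed_eq R 0)).
    by move=> H _; apply: continuousB => //; apply: (@coord_continuous R m m).
  - apply: closed_bigI => x _.
    apply: (@preimage_closed 'M[R]_m R (fun H => qform H x) _ _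
              (@closed_ge R 0)).
    by move=> H _; exact: continuous_qform.
  apply: (@preimage_closed 'M[R]_m R mxtrace _ _ (@closed_eq R 1)).
  move=> H _; apply: (@continuous_sum R 'M[R]_m) => i.
  exact: coord_continuous.
apply/seteqP; split=> [H [[sH pH] trH]|H [[sH pH] trH]].
  split=> //; split=> [[i j] _ /=|x _]; last exact: pH.
  by rewrite -[in H j i]sH mxE subrr.
split=> //; split=> [|x]; last exact: pH.
apply/matrixP => i j; rewrite mxE; apply/eqP; rewrite -subr_eq0; apply/eqP.
exact: (sH (j, i)).
Qed.

(** * Separation *)

Lemma density_convex (R : realType) m (H K : 'M[R]_m) (t : R) :
  density H -> density K -> 0 <= t <= 1 -> density (H + t *: (K - H)).
Proof.
move=> [[sH pH] trH] [[sK pK] trK] /andP[t_ge0 t_le1].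
have -> : H + t *: (K - H) = (1 - t) *: H + t *: K.
  by rewrite scalerBr scalerBl scale1r addrCA addrC.
split; last by rewrite mxtraceD !mxtraceZ trH trK; ring.
split=> [|x].
  by rewrite [trmx (_ + _)]linearD /= ![trmx (_ *: _)]linearZ /= sH sK.
rewrite mulmxDr mulmxDl -!scalemxAr -!scalemxAl [fun_of_matrix (_ + _) _ _]mxE.
by rewrite ![fun_of_matrix (_ *: _) _ _]mxE addr_ge0 ?mulr_ge0 ?subr_ge0.
Qed.

(** The normalized rank-one matrices [v *m v^T] already test negativity. *)
Lemma negdef_density (R : realType) m (L : 'M[R]_m) :
  L^T = L -> (forall H, density H -> \tr (L *m H) < 0) -> negdefmx L.
Proof.
move=> sL negL; split=> // v v_neq0.
pose s := \sum_i v i 0 ^+ 2.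
have tr_vv (M : 'M[R]_m) : \tr (M *m (v *m v^T)) = qform M v.
  by rewrite mulmxA mxtrace_mulC mulmxA trace_mx11.
have s_gt0 : 0 < s.
  have [i vi_neq0] : exists i, v i 0 != 0.
    apply/existsP; apply: contraT => /existsPn v0; case/negP: v_neq0.
    by apply/eqP/colP => i; rewrite mxE; apply/eqP/negbNE/v0.
  exact: (@sumsq_gt0 _ _ (fun j => v j 0) i).
have dens : density (s^-1 *: (v *m v^T)).
  split; last first.
    rewrite mxtraceZ -[v *m v^T]mul1mx tr_vv mulmx1 mxE.
    under eq_bigr do rewrite mxE -expr2.
    by rewrite mulVf ?gt_eqF.
  split=> [|x]; first by rewrite [trmx (_ *: _)]linearZ /= trmx_mul trmxK.
  rewrite -scalemxAr -scalemxAl mxE mulr_ge0 ?invr_ge0 ?(ltW s_gt0) //.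
  rewrite mulmxA -[_ *m v^T *m x]mulmxA -[v^T *m x]trmxK.
  rewrite trmx_mul trmxK mxE big_ord1 [trmx _ _ _]mxE.
  exact: sqr_ge0.
have := negL _ dens; rewrite -scalemxAr mxtraceZ tr_vv pmulr_rlt0 //.
by rewrite invr_gt0.
Qed.

Lemma lyap_entry_continuous (R : realType) n (A B : 'M[R]_n) i :
  continuous (lyap_entry A B i).
Proof.
rewrite /lyap_entry; under eq_fun do rewrite mxE [fun_of_matrix (_ + _) _ _]mxE.
move=> H; apply: (@continuousD R R^o 'M[R]_(n + n)).
  apply: (@continuous_mulmx R 'M[R]_(n + n) _ _ _ (fun=> A) ulsubmx) => k l.
    exact: cst_continuous.
  by under eq_fun do rewrite !mxE; exact: coord_continuous.
apply: (@continuous_mulmx R 'M[R]_(n + n) _ _ _ (fun=> B)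
  (fun H => (ursubmx H)^T)) => k l.
  exact: cst_continuous.
by under eq_fun do rewrite !mxE; exact: coord_continuous.
Qed.

Lemma diag_gap_continuous (R : realType) n (i : 'I_n) :
  continuous (@diag_gap R n i).
Proof.
rewrite /diag_gap; under eq_fun do rewrite !mxE.
move=> H; apply: (@continuousB R R^o 'M[R]_(n + n)); exact: coord_continuous.
Qed.

Lemma lyap_entry_affine (R : realType) n (A B : 'M[R]_n) i
    (H K : 'M[R]_(n + n)) t :
  lyap_entry A B i (H + t *: (K - H)) =
  lyap_entry A B i H + t * (lyap_entry A B i K - lyap_entry A B i H).
Proof.
have ulE : ulsubmx (H + t *: (K - H)) =
    ulsubmx H + t *: (ulsubmx K - ulsubmx H).
  by apply/matrixP => k l; rewrite !mxE.
have urE : (ursubmx (H + t *: (K - H)))^T =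
    (ursubmx H)^T + t *: ((ursubmx K)^T - (ursubmx H)^T).
  by apply/matrixP => k l; rewrite !mxE.
rewrite /lyap_entry ulE urE !mulmxDr -!scalemxAr !mulmxBr.
by do 4!move: (_ *m _); move=> *; rewrite !mxE; ring.
Qed.

Lemma diag_gap_affine (R : realType) n (i : 'I_n) (H K : 'M[R]_(n + n)) t :
  diag_gap i (H + t *: (K - H)) =
  diag_gap i H + t * (diag_gap i K - diag_gap i H).
Proof. rewrite /diag_gap !mxE; ring. Qed.

(** The theorem of the alternative. The alternative condition says that the
    squared distance [f] of [penalty_optimality] is positive at every density
    matrix. By compactness it has a positive minimum, and optimality there
    gives multipliers [p >= 0] and [q] whose combination is at most [- f u].
    Because this bound is uniform, adding a small constant to each [p i] keeps
    it negative, the sum of the [lyap_entry]s being bounded on the compact set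
    of density matrices. *)
Lemma density_separation (R : realType) n (A B : 'M[R]_n) :
  (forall H : 'M[R]_(n + n), possemidefmx H -> H != 0 ->
     diagv (ulsubmx H) = diagv (drsubmx H) ->
     exists i, lyap_entry A B i H < 0) ->
  exists p q : 'I_n -> R, (forall i, 0 < p i) /\
    forall H, density H ->
      \sum_i p i * lyap_entry A B i H + \sum_i q i * diag_gap i H < 0.
Proof.
set y := lyap_entry A B; set z := @diag_gap R n; move=> alt.
(* There is no density matrix when [n = 0]. *)
have [no_dens|/existsNP[H0 /contrapT dens0]] :=
    pselect (forall H : 'M[R]_(n + n), ~ density H).
  by exists (fun=> 1), (fun=> 0); split=> // H /no_dens.
have dens_neq0 : [set H : 'M[R]_(n + n) | density H] !=set0 by exists H0.
pose f H := \sum_i Num.min (y i H) 0 ^+ 2 + \sum_i z i H ^+ 2.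
have f_cont : continuous f.
  move=> H; apply: (@continuousD R R^o 'M[R]_(n + n)).
    apply: (@continuous_sum R 'M[R]_(n + n)) => i K.
    have min_cont : {for K, continuous (fun H => Num.min (y i H) 0)}.
      apply: continuous_min; last exact: cst_continuous.
      exact: lyap_entry_continuous.
    exact: (@continuousM R 'M[R]_(n + n)).
  apply: (@continuous_sum R 'M[R]_(n + n)) => i K.
  by apply: (@continuousM R 'M[R]_(n + n)); exact: diag_gap_continuous.
have [|u /set_mem dens_u umin] :=
  compact_EVT_min dens_neq0 (@density_compact R (n + n)) (f := f).
  exact: continuous_subspaceT.
have [|w _ wmax] := compact_EVT_max dens_neq0 (@density_compact R (n + n))
    (f := fun H => \sum_i y i H).
  apply: continuous_subspaceT; apply: continuous_sum.
  exact: lyap_entry_continuous.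
have f_gt0 : 0 < f u.
  have sumsq_ge0 (a : 'I_n -> R) : 0 <= \sum_j a j ^+ 2.
    by apply: sumr_ge0 => j _; exact: sqr_ge0.
  have u_neq0 : u != 0.
    by apply/eqP => u0; have := dens_u.2; rewrite u0 mxtrace0; lra.
  have [eq_diag|] := eqVneq (diagv (ulsubmx u)) (diagv (drsubmx u)).
    have [i yi_lt0] := alt u dens_u.1 u_neq0 eq_diag.
    apply: ltr_pwDl => //; apply: (@sumsq_gt0 _ _ _ i).
    by rewrite /Num.min yi_lt0 lt_eqF.
  move=> neq_diag; have [i zi_neq0] : exists i, z i u != 0.
    apply/existsP; apply: contraT => /existsPn z0; case/negP: neq_diag.
    by apply/eqP/colP => i; apply/eqP; rewrite -subr_eq0; exact/negbNE/z0.
  by apply: ltr_wpDl => //; exact: (@sumsq_gt0 _ _ _ i).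
(* Adding 1 to the bound on the sum of the [y i] makes [e] times that sum
   strictly smaller than [f u]. *)
pose e := f u / (`|\sum_i y i w| + 1).
have M1_gt0 : 0 < `|\sum_i y i w| + 1 by rewrite ltr_wpDl.
have e_gt0 : 0 < e by rewrite divr_gt0.
exists (fun i => - Num.min (y i u) 0 + e), (fun i => - z i u).
split=> [i|H dens_H].
  by apply: ltr_wpDl => //; rewrite oppr_ge0 ge_min lexx orbT.
have opt : \sum_i - Num.min (y i u) 0 * y i H + \sum_i - z i u * z i H <= - f u.
  apply: penalty_optimality => [i t|i t|t t01]; first exact: lyap_entry_affine.
    exact: diag_gap_affine.
  by apply: umin; apply/mem_set/density_convex.
have bound : e * \sum_i y i H < f u.
  have ySum : \sum_i y i H <= `|\sum_i y i w|.
    by apply: le_trans (wmax H (mem_set dens_H)) (ler_norm _).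
  apply: (@le_lt_trans _ _ (e * `|\sum_i y i w|)).
    by rewrite ler_wpM2l // ltW.
  by rewrite /e mulrAC ltr_pdivrMr // ltr_pM2l // ltrDl.
under eq_bigr do rewrite mulrDl.
by rewrite big_split /= -mulr_sumr; lra.
Qed.

Theorem theorem2p1 (R : realType) (n : nat) (A B : 'M[R]_n) :
  (exists P Q : 'M[R]_n,
     [/\ is_diag_mx P, is_diag_mx Q, posdefmx P, posdefmx Q
       & negdefmx (A^T *m P + P *m A + Q
                   + P *m B *m invmx Q *m B^T *m P)])
  <->
  (forall H : 'M[R]_(n + n),
     possemidefmx H -> H != 0 ->
     diagv (ulsubmx H) = diagv (drsubmx H) ->
     exists i : 'I_n, diagv (A *m ulsubmx H + B *m (ursubmx H)^T) i 0 < 0).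
Proof.
have lyapE (P Q : 'M[R]_n) : P^T = P ->
    A^T *m P + P *m A + Q + P *m B *m invmx Q *m B^T *m P =
    A^T *m P + P *m A + Q + P *m B *m invmx Q *m (P *m B)^T.
  by move=> sP; rewrite trmx_mul sP mulmxA.
have lyap_sym (p q : 'rV[R]_n) :
    let P := diag_mx p in (A^T *m P + P *m A + diag_mx q)^T
    = A^T *m P + P *m A + diag_mx q.
  rewrite /= [trmx _]linearD /= [trmx (_ + _)]linearD /= !trmx_mul trmxK.
  rewrite !tr_diag_mx.
  by rewrite [X in X + _]addrC.
split=> [[P [Q [/diag_mxP[p ->] /diag_mxP[q ->] pP pQ]]]|alt].
  rewrite lyapE ?tr_diag_mx // => negS H psdH H_neq0 eq_diag.
  have negL :=
    (schur_complement _ (lyap_sym p q) (tr_diag_mx q)).2 (conj pQ negS).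
  have := negdef_mxtrace negL psdH H_neq0.
  rewrite mxtrace_lmi ?psdH.1 // /diag_gap eq_diag.
  rewrite [X in _ + X]big1 => [|i _]; last by rewrite subrr mulr0.
  move=> tr_lt0; apply/existsP; apply: contraT => /existsPn y_ge0.
  have : 0 <= \sum_i p 0 i * lyap_entry A B i H.
    apply: sumr_ge0 => i _; apply: mulr_ge0.
      exact: ltW ((posdef_diagP p).1 pP i).
    by rewrite leNgt y_ge0.
  lra.
have [p [q [p_gt0 sep]]] := density_separation alt.
(* The factor 2 balances the one in [mxtrace_lmi]. The sign of [q] is free in
   the separation: [Q] is positive because of the lower right block. *)
pose P := diag_mx (\row_i p i); pose Q := diag_mx (\row_i (2 * q i)).
have sP : P^T = P := tr_diag_mx _.
have sQ : Q^T = Q := tr_diag_mx _.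
have : negdefmx (block_mx (A^T *m P + P *m A + Q) (P *m B) (P *m B)^T (- Q)).
  apply: negdef_density => [|H dens_H].
    by rewrite tr_block_mx trmxK linearN /= sQ lyap_sym.
  rewrite mxtrace_lmi ?dens_H.1.1 //; have := sep H dens_H.
  under [X in 2 * X]eq_bigr do rewrite [fun_of_matrix (\row__ _) _ _]mxE.
  under [X in _ -> _ + X < 0]eq_bigr do
    rewrite [fun_of_matrix (\row__ _) _ _]mxE -mulrA.
  rewrite -mulr_sumr; lra.
move=> /(schur_complement _ (lyap_sym _ _) sQ)[pQ negS].
exists P, Q; split; rewrite ?diag_mx_is_diag ?lyapE //.
by apply/posdef_diagP => i; rewrite mxE.
Qed.
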